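(* Let $A$ be a commutative ring with unit, let $A^*=A\setminus\{0\}$, and let $P_A$ be the set of split polynomials over $A$. Given $f,g\in P_A$, choose positive finite divisors $\delta_f=\sum_{a\in A^*}n_a.(a)$ and $\delta_g=\sum_{b\in A^*}m_b.(b)$ in $\mathcal{D}_0^+(A^* )$ with $\varphi^+_{A^*}(\delta_f)=f$ and $\varphi^+_{A^*}(\delta_g)=g$, and define $$f\star g=\varphi^+_{A^*}(\delta_f\star_{A^*}\delta_g)=\prod_{\substack{a,b\in A^*\\ ab\neq0}}(1-abX)^{n_am_b}=\prod_{c\in A^*}(1-cX)^{\sum_{ab=c}n_am_b}.$$ Then the result $f\star g$ does not depend on the choices of $\delta_f$ and $\delta_g$.
   Context: $\mathbb{N}=\{0,1,2,\dots\}$. $P_A\subset 1+XA[X]$ is the multiplicative semigroup of polynomials that can be written $\prod_{a\in A}(1-aX)^{n_a}$ with $n_a\in\mathbb{N}$, almost all zero. $\mathcal{D}_0^+(A^* )$ is the additive monoid of finite formal sums $\sum_{a\in A^*}n_a.(a)$ with $n_a\in\mathbb{N}$, almost all zero. The map $\varphi^+_{A^*}:\mathcal{D}_0^+(A^* )\to P_A$ is $\sum_{a}n_a.(a)\mapsto\prod_{a\in A^*}(1-aX)^{n_a}$; it is a surjective semigroup morphism. The convolution (eñe product) of divisors on $A^*$ is $$\Big(\sum_a n_a.(a)\Big)\star_{A^*}\Big(\sum_b m_b.(b)\Big)=\sum_{c\in A^*}\Big(\sum_{a,b\in A^*,\ ab=c}n_am_b\Big).(c),$$ i.e. pairs $(a,b)$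 with $ab=0$ in $A$ contribute nothing. *)

(* Defs.v *)
From mathcomp Require Import all_boot all_order all_algebra.
From mathcomp Require Import finmap.

Set Implicit Arguments.
Unset Strict Implicit.
Unset Printing Implicit Defensive.

Import GRing.Theory.
Local Open Scope ring_scope.
Local Open Scope fset_scope.

(* The set A^* = A \ {0}; nonzero elements, not units, of A. *)
Notation nonzero A := {a : A | a != 0}.

Definition split_poly (A : comNzRingType) (f : {poly A}) : Prop :=
  exists n : {fsfun A -> nat with 0%N},
    f = \prod_(a <- finsupp n) (1 - a *: 'X) ^+ n a.

(* Finite positive divisors on A^*, i.e. the monoid D_0^+(A^* ). *)
Definition divisor (A : comNzRingType) : Type :=
  {fsfun nonzero A -> nat with 0%N}.

(* The map phi^+_{A^*}. *)
Definition poly_of_divisor (A : comNzRingType) (d : divisor A) : {poly A} :=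
  \prod_(a <- finsupp d) (1 - val a *: 'X) ^+ d a.

(* The nonzero products ab with a, b in the supports: [insub] is [None] on 0,
   so [pmap insub] discards the pairs with ab = 0. *)
Definition nonzero_products (A : comNzRingType) (d e : divisor A) :
    {fset nonzero A} :=
  [fset c in pmap insub
     [seq val a * val b | a <- enum_fset (finsupp d),
                          b <- enum_fset (finsupp e)]].

Definition ene_conv (A : comNzRingType) (d e : divisor A) : divisor A :=
  [fsfun c in nonzero_products d e =>
     (\sum_(a <- finsupp d) \sum_(b <- finsupp e | (val a * val b)%R == val c)
        d a * e b)%N].

Section EneConv.
Variable A : comNzRingType.
Implicit Types (d e : divisor A) (a b c : nonzero A).

Lemma mem_nonzero_products d e a b c :
  a \in finsupp d -> b \in finsupp e -> val a * val b = val c ->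
  c \in nonzero_products d e.
Proof.
move=> da eb abc; rewrite /nonzero_products !inE /= mem_pmap.
apply/mapP; exists (val c); last by rewrite valK.
by rewrite -abc; apply: allpairs_f.
Qed.

(* The value of the convolution at every c in A^*: restricting its definition
   to [nonzero_products] loses nothing. *)
Lemma ene_convE d e c :
  ene_conv d e c =
  (\sum_(a <- finsupp d) \sum_(b <- finsupp e | (val a * val b)%R == val c)
     d a * e b)%N.
Proof.
rewrite fsfun_fun; case: ifPn => // cN; symmetry.
rewrite big_seq big1 // => a da; rewrite big_seq_cond big1 // => b.
case/andP=> eb /eqP abc; case/negP: cN.
exact: mem_nonzero_products da eb abc.
Qed.

Lemma finsupp_ene_conv d e :
  {subset finsupp (ene_conv d e) <= nonzero_products d e}.
Proof.
move=> c; rewrite mem_finsupp fsfun_fun.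
by case: ifP => //; rewrite eqxx.
Qed.

Lemma poly_of_ene_conv d e :
  poly_of_divisor (ene_conv d e) =
  \prod_(a <- finsupp d) \prod_(b <- finsupp e | val a * val b != 0)
     (1 - (val a * val b) *: 'X) ^+ (d a * e b).
Proof.
rewrite /poly_of_divisor.
transitivity (\prod_(c <- nonzero_products d e)
                 (1 - val c *: 'X) ^+ ene_conv d e c).
  apply: big_fset_incl; first by apply/fsubsetP; apply: finsupp_ene_conv.
  by move=> c _ /fsfun_dflt ->; rewrite expr0.
under eq_bigr => c _.
  rewrite ene_convE expr_sum.
  under eq_bigr => a _ do rewrite expr_sum.
  over.
rewrite exchange_big /= big_seq [RHS]big_seq; apply: eq_bigr => a da.
rewrite (exchange_big_dep xpredT) //= [RHS]big_mkcond.
rewrite big_seq [RHS]big_seq; apply: eq_bigr => b eb.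
case: ifPn => [ab0|]; last first.
  rewrite negbK => /eqP ->; rewrite big1 // => c.
  by rewrite eq_sym (negPf (valP c)).
have cP : Sub (val a * val b) ab0 \in nonzero_products d e.
  exact: mem_nonzero_products da eb _.
rewrite big_mkcond (bigD1_seq _ cP) ?fset_uniq //= eqxx big1 ?mulr1 //.
move=> c; rewrite -val_eqE /= => /negPf cN.
by rewrite eq_sym cN.
Qed.

End EneConv.

(* Main.v *)
(** Factors with [ab = 0] equal [1], so the product over all pairs [(a, b)]
    may be grouped by [a] as the product of the [g(aX)^(n_a)]: it depends on
    [delta_g] only through [g], and by symmetry on [delta_f] only through
    [f]. *)
Require Import Defs.
From mathcomp Require Import all_boot all_order all_algebra.
From mathcomp Require Import finmap.

Import GRing.Theory.
Local Open Scope ring_scope.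

Lemma poly_of_ene_conv_all (A : comNzRingType) (d e : divisor A) :
  poly_of_divisor (ene_conv d e) =
  \prod_(a <- finsupp d) \prod_(b <- finsupp e)
     (1 - (val a * val b) *: 'X) ^+ (d a * e b).
Proof.
rewrite poly_of_ene_conv; apply: eq_bigr => a _.
rewrite big_mkcond; apply: eq_bigr => b _.
by case: eqP => //= ->; rewrite scale0r subr0 expr1n.
Qed.

Lemma poly_of_ene_convC (A : comNzRingType) (d e : divisor A) :
  poly_of_divisor (ene_conv d e) = poly_of_divisor (ene_conv e d).
Proof.
rewrite !poly_of_ene_conv_all exchange_big /=.
by apply: eq_bigr => b _; apply: eq_bigr => a _; rewrite mulrC mulnC.
Qed.

(** Substituting [aX] for [X] is a ring morphism sending [1 - bX] to [1 - abX], so it can be applied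
    factor by factor to the polynomial of [e]. *)
Lemma poly_of_ene_conv_comp (A : comNzRingType) (d e : divisor A) :
  poly_of_divisor (ene_conv d e) =
  \prod_(a <- finsupp d) (poly_of_divisor e \Po (val a *: 'X)) ^+ d a.
Proof.
rewrite poly_of_ene_conv_all; apply: eq_bigr => a _.
rewrite /poly_of_divisor rmorph_prod -prodrXl; apply: eq_bigr => b _.
rewrite rmorphXn rmorphB rmorph1 /= comp_polyZ comp_polyX scalerA.
by rewrite -exprM [val b * _]mulrC [(e b * _)%N]mulnC.
Qed.

Theorem theorem0p5 (A : comNzRingType) (f g : {poly A})
  (hf : split_poly f) (hg : split_poly g)
  (df df' dg dg' : divisor A)
  (hdf : poly_of_divisor df = f) (hdf' : poly_of_divisor df' = f)
  (hdg : poly_of_divisor dg = g) (hdg' : poly_of_divisor dg' = g) :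
  poly_of_divisor (ene_conv df dg) = poly_of_divisor (ene_conv df' dg').
Proof.
(* With [df] fixed, pass from [dg] to [dg'] through their common polynomial [g]. *)
rewrite poly_of_ene_conv_comp hdg -hdg' -poly_of_ene_conv_comp.
(* Commutativity moves [df] to the second slot, where the same exchange gives [df']. *)
rewrite poly_of_ene_convC poly_of_ene_conv_comp hdf -hdf'.
by rewrite -poly_of_ene_conv_comp poly_of_ene_convC.
Qed.
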